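(* Let $\mathcal{M}=\{\mathcal{S},\mathcal{A},p^S,p^R,\rho\}$ be an MDP with finite $\mathcal{S}$ and $\mathcal{A}$ which satisfies Assumption (U) of the context and has either deterministic rewards or independent Gaussian rewards. Consider a tabular model for the optimal action-value function with index function $\nu$ and $\Theta=\mathbb{R}^{d_\Theta}$ (see context), leading to the likelihood, for a dataset $\mathcal{D}$ of triples $(s,a,r)$ with $s\in\mathcal{S}$, $a\in\mathcal{A}_s$, $r\in\mathbb{R}$, and $\epsilon>0$, $$L(\theta|\mathcal{D})=\prod_{(s,a,r)\in\mathcal{D}}\mathcal{N}\Big(r;\theta_{\nu(s,a)}-\sum_{s'\in\mathcal{S}}p^S(s'|s,a)\max_{a'\in\mathcal{A}_{s'}}\theta_{\nu(s',a')},\epsilon^2\Big).$$ Assume furthermore that the MDP contains a non-goal recurrent state $s^r$ corresponding to some improper deterministic policy, and let $u\in[0,1]^{d_\Theta}$ be the vector such that $u_{\nu(s,a)}$ is the maximum probability of leading to $s^r$ from the state-action pair $(s,a)$, that is, $$u_i=\max_{\tilde\pi\in\tilde\Pi}p^{\tilde\pi}\big(S_t=s^r\text{ for some }t\ge1\,\big|\,(S_0,A_0)=\nu^{-1}(i)\big),\quad i=1,\dots,d_\Theta.$$ Then there exists a subset $\mathcal{O}\subseteq\mathbb{R}^{d_\Theta}$ with non-zero Lebesgue measure such that for any $\theta\in\mathcal{O}$ there exists a constant $c_\theta\le0$ satisfying $L(\theta|\mathcal{D})=L(\theta+cu|\mathcal{D})$ for all $c>c_\theta$, all $\epsilon>0$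 and all datasets $\mathcal{D}$.
   Context: An (infinite-horizon, time-homogeneous) MDP $\mathcal{M}=\{\mathcal{S},\mathcal{A},p^S,p^R,\rho\}$ consists of a finite state space $\mathcal{S}$, nonempty finite sets $\mathcal{A}_s$ of admissible actions with $\mathcal{A}=\bigcup_s\mathcal{A}_s$, transition kernels $p^S(\cdot|s,a)$ on $\mathcal{S}$, reward distributions $p^R(\cdot|s,a)$ on $\mathbb{R}$, and an initial state distribution $\rho$. Write $\mathcal{S}\otimes\mathcal{A}=\bigcup_{s\in\mathcal{S}}\{s\}\times\mathcal{A}_s$. A deterministic stationary policy $\pi$ selects an action $\pi(s)\in\mathcal{A}_s$ in each state; $p^\pi$, $\mathbb{E}^\pi$ denote the law and expectation of the process $S_{t+1}\sim p^S(\cdot|S_t,A_t)$, $R_t\sim p^R(\cdot|S_t,A_t)$, $A_t=\pi(S_t)$. The value is $V^\pi(s)=\mathbb{E}^\pi[\sum_{t=0}^\infty R_t|S_0=s]$ (limit of expected partial sums; no discounting). An absorbing (goal) state is a state $s^g$ with a single admissible action, $\mathcal{A}_{s^g}=\{a^g\}$, with $p^S(s^g|s^g,a^g)=1$ and reward $0$ almost surely; $\mathcal{S}^g$ is the set of absorbing states. A deterministic stationary policy $\pi$ is proper if $\lim_{t\to\infty}p^\pi(S_t=s^g|S_0=s_0)=1$ for all $s_0\in\mathcal{S}$, and improper otherwise. Assumption (U): the discount factor is $\gamma=1$; there is a unique absorbing state $s^g$, with $\mathcal{A}_{s^g}=\{a^g\}$ (so $\mathcal{S}^g=\{s^g\}$);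 a proper deterministic stationary policy exists; and for every improper deterministic stationary policy $\pi$ there is $s\in\mathcal{S}$ with $V^\pi(s)=-\infty$. A state $s^r$ is a non-goal recurrent state under a deterministic policy $\pi$ if $s^r\notin\mathcal{S}^g$, $p^\pi(S_t=s^r\text{ for some }t\ge1|S_0=s^r)=1$, and there is $s_0^r\in\mathrm{supp}(\rho)$ with $p^\pi(S_t=s^r\text{ for some }t\ge0|S_0=s_0^r)>0$. Tabular form: $d_\Theta=|\bigcup_{s\in\mathcal{S}\setminus\mathcal{S}^g}\{s\}\times\mathcal{A}_s|$; $\nu:\mathcal{S}\otimes\mathcal{A}\to\{1,\dots,d_\Theta+|\mathcal{S}^g|\}$ is a bijection mapping absorbing state-action pairs into $\{d_\Theta+1,\dots,d_\Theta+|\mathcal{S}^g|\}$; $Q_\theta(s,a)=\theta_{\nu(s,a)}$, with the convention that $\theta_k\equiv0$ for $k>d_\Theta$, for every parameter vector $\theta\in\mathbb{R}^{d_\Theta}$ (in particular also for $\theta+cu$). $\tilde\Pi$ is the set of maps $\tilde\pi:\mathbb{Z}_{\ge1}\times\mathcal{S}\to\mathcal{A}$ with $\tilde\pi(t,s)\in\mathcal{A}_s$ (possibly time-dependent deterministic decision rules used from time $1$ on); $p^{\tilde\pi}(\cdot|S_0=s,A_0=a)$ is the law of the process started at $(s,a)$ with $S_t\sim p^S(\cdot|S_{t-1},A_{t-1})$ and $A_t=\tilde\pi(t,S_t)$ for $t\ge1$. $\mathcal{N}(x;m,\epsilon^2)$ is the Gaussian density with mean $m$ and variance $\epsilon^2$.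 *)

(* Defs.v *)
From HB Require Import structures.
From mathcomp Require Import all_boot all_order all_algebra.
From mathcomp Require Import all_classical all_reals all_analysis.

Set Implicit Arguments.
Unset Strict Implicit.
Unset Printing Implicit Defensive.

Import Order.TTheory GRing.Theory Num.Theory.
Import numFieldNormedType.Exports.

Local Open Scope classical_set_scope.
Local Open Scope ring_scope.

(* The values of [trans] and [rew] at pairs [(s, a)] with [a \notin adm s]
   are junk and are never used. *)
Record mdp (R : realType) (S A : finType) := Mdp {
  adm : S -> {set A} ;
  adm_neq0 : forall s, exists a, a \in adm s ;
  adm_cover : forall a, exists s, a \in adm s ;
  trans : S -> A -> S -> R ;
  trans_ge0 : forall s a s', a \in adm s -> 0 <= trans s a s' ;
  trans_sum1 : forall s a, a \in adm s -> \sum_s' trans s a s' = 1 ;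
  rew : S -> A -> probability R R ;
  init : S -> R ;
  init_ge0 : forall s, 0 <= init s ;
  init_sum1 : \sum_s init s = 1
}.

Section mdp_defs.
Context (R : realType) (S A : finType) (M : mdp R S A).

Definition absorbing (s : S) : Prop :=
  exists a : A, [/\ adm M s = [set a]%SET, trans M s a s = 1 &
    rew M s a [set 0] = 1%E].

Definition absorbing_states : {set S} := [set s | `[< absorbing s >]]%SET.

Definition policy (pi : S -> A) : Prop := forall s, pi s \in adm M s.

(* Decision rules are used from time 1 on: the value of [pit] at time 0 is
   irrelevant. *)
Definition decision_rule (pit : nat -> S -> A) : Prop :=
  forall t s, (0 < t)%N -> pit t s \in adm M s.

Definition deterministic_rewards : Prop :=
  forall s a, a \in adm M s -> exists m : R,
    forall B, measurable B -> rew M s a B = \d_m B.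

(* The reward of the absorbing pair is 0 almost surely, hence only the other
   pairs can have Gaussian rewards.  Independence of the rewards is part of
   [law_cylinder] below. *)
Definition gaussian_rewards : Prop :=
  forall s a, s \notin absorbing_states -> a \in adm M s ->
    exists m sigma : R, 0 < sigma /\
      forall B, measurable B -> rew M s a B = normal_prob m sigma B.

(* The state-action-reward process on a sample space.  [law pit s0 a0] is the
   law of the process started at (S_0, A_0) = (s0, a0) when A_t = pit t S_t is
   used for t >= 1; it is characterised by its finite-dimensional
   distributions: (S_0, A_0) = (s0, a0), S_(t+1) ~ trans S_t A_t,
   A_(t+1) = pit t.+1 S_(t+1), and R_t ~ rew S_t A_t independently given the
   states and actions.  On the trajectory space (S * A * R)^nat it exists by the
   Ionescu-Tulcea theorem, and the probability of every event of the process is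
   determined by these distributions. *)
Record process := Process {
  disp : measure_display ;
  Omega : measurableType disp ;
  state : nat -> Omega -> S ;
  action : nat -> Omega -> A ;
  reward : nat -> {mfun Omega >-> R} ;
  measurable_state : forall t s, measurable [set w | state t w = s] ;
  measurable_action : forall t a, measurable [set w | action t w = a] ;
  law : (nat -> S -> A) -> S -> A -> probability Omega R ;
  law_cylinder : forall (pit : nat -> S -> A) (s0 : S) (a0 : A),
    decision_rule pit -> a0 \in adm M s0 ->
    forall (n : nat) (x : nat -> S) (a : nat -> A) (B : nat -> set R),
    (forall t, measurable (B t)) ->
    law pit s0 a0 [set w | forall t, (t <= n)%N ->
      [/\ state t w = x t, action t w = a t & B t (reward t w)]] =
    (((x 0%N == s0) && (a 0%N == a0))%:R *
     (\prod_(t < n) (trans M (x t) (a t) (x t.+1) *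
                     (a t.+1 == pit t.+1 (x t.+1))%:R)) *
     (\prod_(t < n.+1) fine (rew M (x t) (a t) (B t))))%:E
}.

Arguments state : clear implicits.

Section process_defs.
Variable X : process.

(* p^pi( . | S_0 = s) for a stationary policy pi *)
Definition policy_law (pi : S -> A) (s : S) : probability (Omega X) R :=
  law X (fun=> pi) s (pi s).

(* [lim] is the default 0, and not -oo, when the limit does not exist. *)
Definition value (pi : S -> A) (s : S) : \bar R :=
  limn (fun T : nat =>
    ('E_(policy_law pi s) [fun w => (\sum_(t < T) reward X t w)%R])%E).

Definition proper_policy (sg : S) (pi : S -> A) : Prop :=
  forall s0, policy_law pi s0 [set w | state X t w = sg] @[t --> \oo] --> 1%E.

Record assumption_U (sg : S) : Prop := AssumptionU {
  unique_absorbing : absorbing_states = [set sg]%SET ;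
  proper_policy_exists : exists2 pi, policy pi & proper_policy sg pi ;
  improper_value : forall pi, policy pi -> ~ proper_policy sg pi ->
    exists s, value pi s = -oo%E
}.

Definition nongoal_recurrent (pi : S -> A) (sr : S) : Prop :=
  [/\ sr \notin absorbing_states,
      policy_law pi sr
        [set w | exists2 t : nat, (1 <= t)%N & state X t w = sr] = 1%E &
      exists s0, 0 < init M s0 /\
        (0 < policy_law pi s0 [set w | exists t : nat, state X t w = sr])%E].

Definition reach_probability (pit : nat -> S -> A) (s : S) (a : A) (sr : S) :
    \bar R :=
  law X pit s a [set w | exists2 t : nat, (1 <= t)%N & state X t w = sr].

End process_defs.

Definition dTheta : nat :=
  #|[set z : S * A | (z.1 \notin absorbing_states) && (z.2 \in adm M z.1)]%SET|.

(* Indices are 0-based: the parameters are 0, ..., dTheta - 1 and the absorbing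
   pairs are mapped to dTheta, ..., dTheta + #|absorbing_states| - 1. *)
Definition index_function
    (nu : S * A -> 'I_(dTheta + #|absorbing_states|)) : Prop :=
  set_bij [set z : S * A | z.2 \in adm M z.1] setT nu /\
  forall s a, s \in absorbing_states -> a \in adm M s ->
    (dTheta <= nu (s, a))%N.

Section tabular.
Variable nu : S * A -> 'I_(dTheta + #|absorbing_states|).

(* theta is padded with zeros *)
Definition Qtab (theta : 'rV[R]_dTheta) (s : S) (a : A) : R :=
  (row_mx theta (0 : 'rV[R]_#|absorbing_states|)) 0 (nu (s, a)).

Definition max_adm (s : S) (f : A -> R) : R :=
  \big[Num.max/f (xchoose (adm_neq0 M s))]_(a in adm M s) f a.

Definition likelihood (eps : R) (D : seq (S * A * R)) (theta : 'rV[R]_dTheta) :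
    R :=
  \prod_(z <- D) let: (s, a, r) := z in
    normal_pdf
      (Qtab theta s a -
       \sum_s' trans M s a s' * max_adm s' (Qtab theta s')) eps r.

End tabular.

Definition dataset (D : seq (S * A * R)) : Prop :=
  forall s a r, (s, a, r) \in D -> a \in adm M s.

End mdp_defs.

Definition is_max d (T : porderType d) (E : set T) (m : T) : Prop :=
  E m /\ ubound E m.

Section lebesgue.
Context (R : realType) (n : nat).

Definition box (a b : 'rV[R]_n) : set 'rV[R]_n :=
  [set x | forall i, a 0 i <= x 0 i <= b 0 i].

(* Lebesgue (outer) measure on R^n: infimum of the total volume of the countable
   covers by boxes.  A set is Lebesgue measurable when it is
   [lebesgue_rV.-caratheodory]. *)
Definition lebesgue_rV (E : set 'rV[R]_n) : \bar R :=
  ereal_inf [set v | exists (K : set nat) (a b : nat -> 'rV[R]_n),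
    [/\ forall k, K k -> forall i, a k 0 i <= b k 0 i,
        E `<=` \bigcup_(k in K) box (a k) (b k) &
        v = (\esum_(k in K) (\prod_i (b k 0 i - a k 0 i))%:E)%E]].

End lebesgue.

(* Main.v *)
Require Import Defs.
From HB Require Import structures.
From mathcomp Require Import all_boot all_order all_algebra.
From mathcomp Require Import all_classical all_reals all_analysis.
From mathcomp Require Import measurable_realfun.

Set Implicit Arguments.
Unset Strict Implicit.
Unset Printing Implicit Defensive.

Import Order.TTheory GRing.Theory Num.Theory.
Import numFieldNormedType.Exports.

Local Open Scope classical_set_scope.
Local Open Scope ring_scope.

(** Let [Q*] be the table of maximal probabilities of reaching [sr], padded with
    zeros at the absorbing pairs.  Since [sr] is recurrent under some policy,
    [max_a Q*(sr, a) = 1], so [Q*] solves the reward-free Bellman optimality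
    equation [Q*(s, a) = sum_s' p(s'|s, a) max_a' Q*(s', a')]; this is obtained
    as the limit of finite-horizon dynamic programming.  Fix a greedy policy
    [astar] of [Q*].  As long as [astar] is also greedy for [theta], adding a
    nonnegative multiple of [Q*] keeps it greedy, hence leaves the Bellman
    residuals of [theta], and thus the likelihood, unchanged.  A unit box whose
    [astar] coordinates lie in [[2, 3]] and whose other coordinates lie in
    [[0, 1]] consists of such [theta], and one can take [c_theta = 0]. *)

(** * Boxes and Lebesgue measure on R^n *)

Section lebesgue_rV_outer_measure.
Context (R : realType) (n : nat).
Implicit Types (E F : set 'rV[R]_n) (a b : nat -> 'rV[R]_n) (K : set nat).

Let vol (x y : 'rV[R]_n) : \bar R := (\prod_i (y 0 i - x 0 i))%:E.

Let box_cover E K a b :=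
  (forall k, K k -> forall i, a k 0 i <= b k 0 i) /\
  E `<=` \bigcup_(k in K) box (a k) (b k).

Let vol_ge0 (x y : 'rV[R]_n) : (forall i, x 0 i <= y 0 i) -> (0 <= vol x y)%E.
Proof. by move=> xy; rewrite lee_fin prodr_ge0// => i _; rewrite subr_ge0. Qed.

Let box_cover_ge0 E K a b : box_cover E K a b ->
  (0 <= \esum_(k in K) vol (a k) (b k))%E.
Proof. by move=> [ab _]; apply: esum_ge0 => k Kk; exact/vol_ge0/ab. Qed.

Let lebesgue_rV_le E K a b : box_cover E K a b ->
  (lebesgue_rV E <= \esum_(k in K) vol (a k) (b k))%E.
Proof. by move=> [ab EK]; apply: ereal_inf_lbound; exists K, a, b. Qed.

Let lebesgue_rV_ge E v : (forall K a b, box_cover E K a b ->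
  (v <= \esum_(k in K) vol (a k) (b k))%E) -> (v <= lebesgue_rV E)%E.
Proof.
by move=> vE; apply: le_ereal_inf_tmp => _ [K [a [b [ab EK ->]]]]; exact: vE.
Qed.

Lemma lebesgue_rV_ge0 E : (0 <= lebesgue_rV E)%E.
Proof. by apply: lebesgue_rV_ge => K a b; exact: box_cover_ge0. Qed.

Lemma lebesgue_rV0 : lebesgue_rV (set0 : set 'rV[R]_n) = 0%E.
Proof.
apply/eqP; rewrite eq_le lebesgue_rV_ge0 andbT.
(* The cover must have an empty index set: in dimension 0 every box has volume 1, so a nonempty
   cover never has small volume. *)
have := @lebesgue_rV_le set0 set0 (fun=> 0) (fun=> 0).
by rewrite esum_set0; apply; split=> // x [].
Qed.

Lemma le_lebesgue_rV : {homo @lebesgue_rV R n : E F / E `<=` F >-> (E <= F)%E}.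
Proof.
move=> E F EF; apply: lebesgue_rV_ge => K a b [ab FK].
by apply: lebesgue_rV_le; split=> //; exact: subset_trans FK.
Qed.

(** Each [F j] gets a cover that is optimal up to [e / 2 ^ j.+1]; together these covers form one
    countable cover of the union, with total error at most [e]. *)
Lemma lebesgue_rV_sigma_subadditive : sigma_subadditive (@lebesgue_rV R n).
Proof.
move=> F; have [[i Fioo]|] := pselect (exists i, lebesgue_rV (F i) = +oo%E).
  rewrite (eseries_pinfty _ _ Fioo) ?leey// => j _.
  by rewrite -ltNye (lt_le_trans _ (lebesgue_rV_ge0 _)).
rewrite -forallNE => Foo; apply/lee_addgt0Pr => e e0.
rewrite (le_trans _ (epsilon_trick _ _ (ltW e0)))//; last first.
  by move=> j; exact: lebesgue_rV_ge0.
have [|G GP] := @choice _ _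
  (fun j (G : set nat * (nat -> 'rV[R]_n) * (nat -> 'rV[R]_n)) =>
    box_cover (F j) G.1.1 G.1.2 G.2 /\
    (\esum_(k in G.1.1) vol (G.1.2 k) (G.2 k) <=
     lebesgue_rV (F j) + (e / (2 ^ j.+1)%:R)%:E)%E).
  move=> j; have ej : 0 < e / (2 ^ j.+1)%:R.
    by rewrite divr_gt0// ltr0n expn_gt0.
  have Ffin : lebesgue_rV (F j) \is a fin_num.
    by rewrite ge0_fin_numE ?lebesgue_rV_ge0// ltey; exact/eqP.
  have [_ [K [a [b [ab FK ->]]]] /ltW lt] := lb_ereal_inf_adherent ej Ffin.
  by exists (K, a, b).
pose K := [set: nat] `*`` fun j => (G j).1.1.
pose a m := if unpickle m is Some p then (G p.1).1.2 p.2 else 0 : 'rV[R]_n.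
pose b m := if unpickle m is Some p then (G p.1).2 p.2 else 0 : 'rV[R]_n.
have aE (p : nat * nat) : a (pickle p) = (G p.1).1.2 p.2 by rewrite /a pickleK.
have bE (p : nat * nat) : b (pickle p) = (G p.1).2 p.2 by rewrite /b pickleK.
have cov : box_cover (\bigcup_j F j) (pickle @` K) a b.
  split=> [_ [p [_ Kp] <-] i|x [j _ Fjx]].
    by rewrite aE bE; exact: (GP p.1).1.1.
  have [k Kk xk] := (GP j).1.2 _ Fjx.
  by exists (pickle (j, k)); [exists (j, k)|rewrite aE bE].
apply: (le_trans (lebesgue_rV_le cov)).
rewrite esum_image; last by move=> p q _ _; exact: (pcan_inj pickleK).
under eq_esum do rewrite aE bE.
rewrite -(@esum_esum _ _ _ _ _
  (fun j k => vol ((G j).1.2 k) ((G j).2 k))); last first.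
  by move=> j k _ Kk; apply: vol_ge0; exact: (GP j).1.1.
rewrite -nneseries_esumT; last by move=> j; exact: box_cover_ge0 (GP j).1.
apply: lee_nneseries => [j _ _|j _]; last exact: (GP j).2.
exact: box_cover_ge0 (GP j).1.
Qed.

HB.instance Definition _ := isOuterMeasure.Build R 'rV[R]_n (@lebesgue_rV R n)
  lebesgue_rV0 lebesgue_rV_ge0 le_lebesgue_rV lebesgue_rV_sigma_subadditive.

(* A closed box cut by the hyperplane [x_i = t] gives two closed boxes whose
   volumes add up exactly, so a cover of [E] splits at no cost. *)
Lemma lebesgue_rV_split (i : 'I_n) (t : R) E F1 F2 :
  F1 `<=` [set x | x 0 i <= t] -> F2 `<=` [set x | t <= x 0 i] ->
  (lebesgue_rV (E `&` F1) + lebesgue_rV (E `&` F2) <= lebesgue_rV E)%E.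
Proof.
move=> F1t F2t; apply: lebesgue_rV_ge => K a b [ab EK].
pose b1 k : 'rV[R]_n :=
  \row_j (if j == i then Num.min (b k 0 i) t else b k 0 j).
pose a2 k : 'rV[R]_n :=
  \row_j (if j == i then Num.max (a k 0 i) t else a k 0 j).
(* Boxes that miss a half-space are dropped from its cover, since cutting them would put their
   corners in the wrong order. *)
pose K1 := [set k | a k 0 i <= t]; pose K2 := [set k | t <= b k 0 i].
have ab1 k : K k -> K1 k -> forall j, a k 0 j <= b1 k 0 j.
  move=> Kk K1k j; rewrite mxE; case: eqP => [->|_]; last exact: ab.
  by rewrite le_min ab.
have ab2 k : K k -> K2 k -> forall j, a2 k 0 j <= b k 0 j.
  move=> Kk K2k j; rewrite mxE; case: eqP => [->|_]; last exact: ab.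
  by rewrite ge_max ab.
have cov1 : box_cover (E `&` F1) (K `&` K1) a b1.
  split=> [k []|x [Ex /F1t xt]]; first exact: ab1.
  have [k Kk xk] := EK _ Ex; have /andP[aik bik] := xk i.
  exists k; first by split=> //; exact: le_trans xt.
  move=> j; rewrite mxE; case: eqP => [->|_]; last exact: xk.
  by rewrite aik le_min bik.
have cov2 : box_cover (E `&` F2) (K `&` K2) a2 b.
  split=> [k []|x [Ex /F2t xt]]; first exact: ab2.
  have [k Kk xk] := EK _ Ex; have /andP[aik bik] := xk i.
  exists k; first by split=> //; exact: le_trans bik.
  move=> j; rewrite mxE; case: eqP => [->|_]; last exact: xk.
  by rewrite bik ge_max aik xt.
rewrite (le_trans (leeD (lebesgue_rV_le cov1) (lebesgue_rV_le cov2)))//.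
rewrite !esum_mkcondr -esumD; last 2 first.
- by move=> k Kk; case: ifPn => //; rewrite inE => K1k; exact/vol_ge0/ab1.
- by move=> k Kk; case: ifPn => //; rewrite inE => K2k; exact/vol_ge0/ab2.
apply: le_esum => k Kk; have abk := ab k Kk.
pose P := \prod_(j | j != i) (b k 0 j - a k 0 j).
have P0 : 0 <= P by rewrite prodr_ge0// => j _; rewrite subr_ge0.
have volE : vol (a k) (b k) = ((b k 0 i - a k 0 i) * P)%:E.
  by rewrite /vol (bigD1 i).
have vol1 : vol (a k) (b1 k) = ((Num.min (b k 0 i) t - a k 0 i) * P)%:E.
  rewrite /vol (bigD1 i)//= mxE eqxx; congr (_ * _)%:E.
  by apply: eq_bigr => j /negbTE ji; rewrite mxE ji.
have vol2 : vol (a2 k) (b k) = ((b k 0 i - Num.max (a k 0 i) t) * P)%:E.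
  rewrite /vol (bigD1 i)//= mxE eqxx; congr (_ * _)%:E.
  by apply: eq_bigr => j /negbTE ji; rewrite mxE ji.
rewrite volE vol1 vol2 !mem_setE /K1 /K2 /=.
(* If the hyperplane meets the box, the two pieces add up to it; if the box lies strictly on one
   side, the only piece kept is the whole box. The last case is settled by nonnegativity of the
   volume. *)
case: ifPn => [ait|]; [case: ifPn => [bit|]|case: ifPn => [bit|]].
- by rewrite -EFinD lee_fin -mulrDl (max_idPr ait) (min_idPr bit) addrC subrKA.
- rewrite -ltNge adde0 lee_fin => bit.
  by rewrite (min_idPl (ltW bit)).
- by rewrite -ltNge add0e lee_fin => ait; rewrite (max_idPl (ltW ait)).
- by move=> _ _; rewrite adde0 lee_fin mulr_ge0// subr_ge0.
Qed.

(** A box is a finite intersection of coordinate half-spaces, and [lebesgue_rV_split] is the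
    Caratheodory criterion for each of them. *)
Lemma caratheodory_box (l h : 'rV[R]_n) :
  (@lebesgue_rV R n).-caratheodory (box l h).
Proof.
have -> : box l h = \big[setI/setT]_(i < n)
    ([set x | l 0 i <= x 0 i] `&` [set x | x 0 i <= h 0 i]).
  rewrite -bigcap_seq; apply/seteqP; split=> x H i.
    by move=> _; exact/andP/H.
  by apply/andP; apply: H => /=; exact: mem_index_enum.
elim/big_ind: _ => [|A B|i _].
- rewrite -setC0; apply: (@caratheodory_measurable_setC _ _ (@lebesgue_rV R n)).
  exact: (@caratheodory_measurable_set0 _ _ (@lebesgue_rV R n)).
- exact: (@caratheodory_measurable_setI _ _ (@lebesgue_rV R n)).
apply: (@caratheodory_measurable_setI _ _ (@lebesgue_rV R n));
  apply: (@le_caratheodory_measurable _ _ (@lebesgue_rV R n)) => E /=.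
- rewrite addeC; apply: (@lebesgue_rV_split i (l 0 i)) => // x /=.
  by move/negP; rewrite -ltNge => /ltW.
- apply: (@lebesgue_rV_split i (h 0 i)) => // x /=.
  by move/negP; rewrite -ltNge => /ltW.
Qed.

End lebesgue_rV_outer_measure.

(** * Lower bound on the volume of covers of a box *)

Lemma le_box_cover_volume (R : realType) n (K : set nat) (l h : nat -> R)
    (a b : nat -> nat -> R) :
  (forall i, (i < n)%N -> l i <= h i) ->
  (forall k, K k -> forall i, (i < n)%N -> a k i <= b k i) ->
  (forall x : nat -> R, (forall i, (i < n)%N -> l i <= x i <= h i) ->
    exists2 k, K k & forall i, (i < n)%N -> a k i <= x i <= b k i) ->
  ((\prod_(i < n) (h i - l i))%:E <=
   \esum_(k in K) (\prod_(i < n) (b k i - a k i))%:E)%E.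
Proof.
(* Each slice [x_n = t] is covered by the boxes it meets, so the induction
   hypothesis bounds its volume; then integrate over [t]. *)
move=> lh; elim: n K lh => [|n IHn] K lh ab cov.
  (* In dimension 0 all volumes are 1, so one index in [K] is enough; covering the point [l]
     provides it. *)
  have [//|k Kk _] := cov l; apply: esum_ge; exists [set k].
    by split; [exact: finite_set1|move=> _ ->].
  by rewrite fsbig_set1 !big_ord0.
pose I k := `[a k n, b k n]%classic.
pose D := `[l n, h n]%classic.
pose P := \prod_(i < n) (h i - l i).
pose v k := \prod_(i < n) (b k i - a k i).
(* Volume of the projection of box [k] to the first [n] coordinates, set to 0 off [K] so that sums
   over [K] become series over [nat]. *)
pose c k := if k \in K then v k else 0.
have P0 : 0 <= P.
  by rewrite prodr_ge0// => i _; rewrite subr_ge0 lh// ltnW// ltnS.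
have c0 k : 0 <= c k.
  rewrite /c; case: ifPn => //; rewrite inE => Kk.
  by rewrite prodr_ge0// => i _; rewrite subr_ge0 ab// ltnW// ltnS.
have slice t : D t -> (P%:E <= \sum_(k <oo) (c k * \1_(I k) t)%:E)%E.
  move=> Dt.
  apply: (@le_trans _ _ (\esum_(k in K `&` [set k | I k t]) (v k)%:E)).
    apply: IHn => [i ni|k [Kk _] i ni|x xlh].
    - by rewrite lh// ltnW// ltnS.
    - by rewrite ab// ltnW// ltnS.
    (* A point of the slice is lifted to dimension [n.+1] by giving it last coordinate [t]; a box
       that contains the lift has [t] in [I k]. *)
    have [i ni|k Kk xk] := cov (fun i => if i == n then t else x i).
      case: eqP => [->|/eqP ni']; first by move: Dt; rewrite /D /= in_itv.
      by rewrite xlh// ltn_neqAle ni' -ltnS.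
    exists k.
      by split=> //; have := xk n (ltnSn n); rewrite eqxx /I /= in_itv.
    by move=> i ni; have := xk i (ltnW ni); rewrite ltn_eqF.
  rewrite esum_mkcond nneseries_esumT; last first.
    by move=> k; rewrite lee_fin mulr_ge0.
  apply: le_esum => k _; rewrite /c indicE in_setI.
  have [_|_] := boolP (k \in K); last by rewrite mul0r.
  have -> : (k \in [set k | I k t]) = (t \in I k).
    by apply/idP/idP; rewrite !inE.
  by case: (t \in I k); rewrite ?mulr1 ?mulr0.
have mD : measurable D by exact: measurable_itv.
have mI k : measurable (I k) by exact: measurable_itv.
have mf k : measurable_fun D (fun t => (c k * \1_(I k) t)%:E).
  by apply/measurable_EFinP; apply: measurable_funM.
have f0 k t : D t -> (0 <= (c k * \1_(I k) t)%:E)%E.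
  by move=> _; rewrite lee_fin mulr_ge0.
have mI_itv (x y : R) : x <= y -> lebesgue_measure `[x, y]%classic = (y - x)%:E.
  rewrite lebesgue_measure_itv/= lte_fin le_eqVlt => /predU1P[->|->].
    by rewrite ltxx subrr.
  by rewrite EFinB.
have Dc : ((\prod_(i < n.+1) (h i - l i))%:E =
    \int[lebesgue_measure]_(x in D) P%:E)%E.
  rewrite integral_cst// big_ord_recr EFinM; congr (_ * _)%E.
  exact/esym/mI_itv/lh.
rewrite Dc; apply: (@le_trans _ _
    (\int[lebesgue_measure]_(t in D) \sum_(k <oo) (c k * \1_(I k) t)%:E)%E).
  apply: ge0_le_integral => //.
  by apply: ge0_emeasurable_sum => [k t Dt _|k _]; [exact: f0|exact: mf].
(* Series and integral are exchanged, all terms being nonnegative; the comparison is then made box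
   by box. *)
rewrite integral_nneseries// esum_mkcond -nneseries_esumT; last first.
  move=> k; case: ifPn => //; rewrite inE lee_fin => Kk.
  by rewrite prodr_ge0// => i _; rewrite subr_ge0 ab.
apply: lee_nneseries => [k _ _|k _].
  by apply: integral_ge0 => t; exact: f0.
under eq_integral do rewrite EFinM.
rewrite ge0_integralZl_EFin//; last first.
  by apply/measurable_EFinP; apply: measurable_indic; exact: mI.
rewrite integral_indic//; last exact: mI.
rewrite /c; case: ifPn => [|_]; last by rewrite mul0e.
rewrite inE => Kk; rewrite big_ord_recr/= EFinM; apply: lee_wpmul2l.
  by have := c0 k; rewrite /c mem_set// lee_fin.
(* The integral over [D] only sees the part of [I k] inside [D], whose length is at most that of
   [I k]. *)
rewrite -mI_itv ?ab//; apply: le_measure; rewrite ?inE; [|exact: mI|].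
- by apply: measurableI => //; exact: mI.
- exact: subIsetl.
Qed.

(** This is what makes a box with positive side lengths non-null. *)
Lemma lebesgue_rV_box (R : realType) n (l h : 'rV[R]_n) :
  (forall i, l 0 i <= h 0 i) ->
  ((\prod_i (h 0 i - l 0 i))%:E <= lebesgue_rV (box l h))%E.
Proof.
move=> lh; apply: le_ereal_inf_tmp => _ [K [a [b [ab cov ->]]]].
(* [le_box_cover_volume] takes points as functions on [nat], which suits its induction on the
   dimension; row vectors are extended by 0. *)
pose f (x : 'rV[R]_n) (i : nat) := if insub i is Some j then x 0 j else 0.
have fE x (i : 'I_n) : f x i = x 0 i by rewrite /f valK.
have prodE (x y : 'rV[R]_n) :
    \prod_i (x 0 i - y 0 i) = \prod_(i < n) (f x i - f y i).
  by apply: eq_bigr => i _; rewrite !fE.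
under eq_esum do rewrite prodE.
rewrite prodE; apply: (le_box_cover_volume (a := f \o a) (b := f \o b)) => /=.
- by move=> i ni; rewrite !(fE _ (Ordinal ni)).
- by move=> k Kk i ni; rewrite !(fE _ (Ordinal ni)); exact: ab.
move=> x xlh; have [|k Kk xk] := cov (\row_i x i).
  by move=> i; rewrite mxE -!fE; exact: xlh.
exists k => // i ni; rewrite !(fE _ (Ordinal ni)).
by have := xk (Ordinal ni); rewrite mxE.
Qed.

(** * Reaching a state in an MDP *)

(** Used below to split an event according to the next state and the next action. *)
Lemma measure_finite_partition d (T : measurableType d) (R : realType)
    (mu : {measure set T -> \bar R}) (I : finType) (g : T -> I) (E : set T) :
  measurable E -> (forall i, measurable [set w | g w = i]) ->
  mu E = (\sum_i mu (E `&` [set w | g w = i]))%E.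
Proof.
move=> mE mg.
suff H (s : seq I) : uniq s ->
    measurable (E `&` [set w | g w \in s]) /\
    mu (E `&` [set w | g w \in s]) =
    (\sum_(i <- s) mu (E `&` [set w | g w = i]))%E.
  have [_ <-] := H _ (index_enum_uniq I); congr (mu _).
  by apply/seteqP; split=> [w Ew|w []//]; split=> //=; rewrite mem_index_enum.
elim: s => [_|i s IHs /= /andP[is_ /IHs[ms {}IHs]]].
  have -> : E `&` [set w | g w \in [::]] = set0.
    by apply/seteqP; split=> w //= [].
  by rewrite big_nil measure0.
have -> : E `&` [set w | g w \in i :: s] =
    (E `&` [set w | g w = i]) `|` (E `&` [set w | g w \in s]).
  apply/seteqP; split=> w /=; rewrite inE.
    by case=> Ew /orP[/eqP|]; [left|right].
  by case=> -[Ew]; [move=> -> | move=> ->]; rewrite ?eqxx ?orbT.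
have mi : measurable (E `&` [set w | g w = i]) by exact: measurableI.
split; first exact: measurableU.
rewrite big_cons -IHs measureU//; apply/seteqP; split=> w //= [[_ ->] [_]].
by rewrite (negbTE is_).
Qed.

Section max_adm_theory.
Context (R : realType) (S A : finType) (M : mdp R S A).
Implicit Types (s : S) (f : A -> R).

Lemma max_adm_ge s f a : a \in adm M s -> f a <= max_adm M s f.
Proof. by move=> aM; rewrite /max_adm (bigD1 a)//= le_max lexx. Qed.

Lemma max_adm_attained s f : exists2 a, a \in adm M s & max_adm M s f = f a.
Proof.
rewrite /max_adm; elim/big_ind: _ => [|x y [a aM ->] [b bM ->]|a aM].
- by exists (xchoose (adm_neq0 M s)) => //; exact: xchooseP.
- by case: (leP (f a) (f b)) => _; [exists b|exists a].
- by exists a.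
Qed.

Lemma max_admE s f a : a \in adm M s ->
  (forall b, b \in adm M s -> f b <= f a) -> max_adm M s f = f a.
Proof.
move=> aM fa; apply/le_anti; rewrite max_adm_ge// andbT.
by have [b bM ->] := max_adm_attained s f; exact: fa.
Qed.

Lemma exists_greedy (f : S -> A -> R) :
  exists pi, policy M pi /\ forall s, max_adm M s (f s) = f s (pi s).
Proof.
have [|pi piP] :=
    @choice _ _ (fun s a => a \in adm M s /\ max_adm M s (f s) = f s a).
  by move=> s; have [a aM fa] := max_adm_attained s (f s); exists a.
by exists pi; split=> s; have [] := piP s.
Qed.

End max_adm_theory.

Section reachability.
Context (R : realType) (S A : finType) (M : mdp R S A) (X : process M) (sr : S).

(* [hit pit n m s a]: probability of being in [sr] at some time in
   [m + 1, ..., m + n] when [(S_m, A_m) = (s, a)]. *)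
Fixpoint hit (pit : nat -> S -> A) (n m : nat) (s : S) (a : A) : R :=
  if n is n'.+1 then
    \sum_s' trans M s a s' *
      (if s' == sr then 1 else hit pit n' m.+1 s' (pit m.+1 s'))
  else 0.

(** Finite-horizon dynamic programming for reaching [sr] within [n] steps. Unlike [hit] it carries
    no clock: the optimum depends on the number of remaining steps only. *)
Fixpoint hit_opt (n : nat) (s : S) (a : A) : R :=
  if n is n'.+1 then
    \sum_s' trans M s a s' *
      (if s' == sr then 1 else max_adm M s' (hit_opt n' s'))
  else 0.

Lemma hit_le_hit_opt pit n m s a : decision_rule M pit ->
  a \in adm M s -> hit pit n m s a <= hit_opt n s a.
Proof.
move=> pitM; elim: n m s a => [|n IHn] m s a aM //=.
apply: ler_sum => s' _; apply: ler_wpM2l; first exact: trans_ge0.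
case: ifP => // _; have aM' := pitM m.+1 s' isT.
by rewrite (le_trans (IHn _ _ _ aM'))// max_adm_ge.
Qed.

Lemma hit_opt_attained N : exists2 pit, decision_rule M pit &
  forall s a, hit pit N 0 s a = hit_opt N s a.
Proof.
have [pi piP] := @choice _ _ _ (fun n => exists_greedy M (hit_opt n)).
(* At time [t] there remain [N - t] steps, so the rule plays greedily for [hit_opt (N - t)]; this is
   where time-dependent rules are essential. *)
exists (fun t => pi (N - t)%N) => [t s _|s a]; first exact: (piP _).1.
suff H n m s' a' : (n + m = N)%N ->
    hit (fun t => pi (N - t)%N) n m s' a' = hit_opt n s' a'.
  by apply: H; rewrite addn0.
elim: n m s' a' => [//|n IHn] m {}s {}a nmN /=.
apply: eq_bigr => s' _; case: ifP => // _.
have nmN' : (n + m.+1 = N)%N by rewrite addnS -addSn.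
by rewrite IHn// (piP _).2 -nmN' addnK.
Qed.

Lemma hit_opt_ge0 n s a : a \in adm M s -> 0 <= hit_opt n s a.
Proof.
elim: n s a => [//|n IHn] s a aM /=; apply: sumr_ge0 => s' _.
apply: mulr_ge0; first exact: trans_ge0.
case: ifP => // _.
by have [b bM ->] := max_adm_attained M s' (hit_opt n s'); exact: IHn.
Qed.

Lemma hit_optS n s a : a \in adm M s -> hit_opt n s a <= hit_opt n.+1 s a.
Proof.
elim: n s a => [|n IHn] s a aM; first exact: hit_opt_ge0.
rewrite [leLHS]/= [leRHS]/=; apply: ler_sum => s' _.
apply: ler_wpM2l; first exact: trans_ge0.
case: ifP => // _; have [b bM ->] := max_adm_attained M s' (hit_opt n s').
by rewrite (le_trans (IHn _ _ bM))// max_adm_ge.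
Qed.

Lemma hit_opt_nd s a : a \in adm M s ->
  {homo (fun n => hit_opt n s a) : n m / (n <= m)%N >-> n <= m}.
Proof.
move=> aM; apply: homo_leq => [//|x y z xy /(le_trans xy)//|n].
exact: hit_optS.
Qed.

(** * From the law of the process to the recursion [hit] *)

Let upd (T : Type) (x : nat -> T) m y := fun t => if t == m then y else x t.

Let cylinder (m : nat) (x : nat -> S) (a : nat -> A) : set (Omega X) :=
  [set w | forall t, (t <= m)%N -> state t w = x t /\ action t w = a t].

Let hitting (m n : nat) : set (Omega X) :=
  [set w | exists2 t, (m < t <= m + n)%N & state t w = sr].

Let measurable_cylinder m x a : measurable (cylinder m x a).
Proof.
have -> : cylinder m x a = \bigcap_(t in `I_m.+1)
    ([set w | state t w = x t] `&` [set w | action t w = a t]).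
  by apply/seteqP; split=> w /= H t; exact: H.
apply: bigcap_measurable => [|t _]; first by exists 0%N.
by apply: measurableI; [exact: measurable_state|exact: measurable_action].
Qed.

Let measurable_hitting m n : measurable (hitting m n).
Proof.
have -> : hitting m n = \bigcup_(t in [set t | (m < t <= m + n)%N])
    [set w | state t w = sr] by [].
by apply: bigcup_measurable => t _; exact: measurable_state.
Qed.

Let path_weight pit s0 a0 (m : nat) (x : nat -> S) (a : nat -> A) : R :=
  ((x 0%N == s0) && (a 0%N == a0))%:R *
  \prod_(t < m) (trans M (x t) (a t) (x t.+1) *
                 (a t.+1 == pit t.+1 (x t.+1))%:R).

Let law_cylinder_weight pit s0 a0 m x a :
  decision_rule M pit -> a0 \in adm M s0 ->
  law X pit s0 a0 (cylinder m x a) = (path_weight pit s0 a0 m x a)%:E.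
Proof.
move=> pitM a0M.
have := @law_cylinder _ _ _ _ X _ _ _ pitM a0M m x a (fun=> setT)
  (fun=> measurableT).
rewrite [X in _ * X]big1 ?mulr1 => [<-|t _]; last by rewrite probability_setT.
congr (law _ _ _ _ _); apply/seteqP.
by split=> w /= H t tm; have [] := H t tm.
Qed.

(** The Markov property for the hitting event: given the path up to time [m], only its last pair
    matters. The induction on [n] splits on the state and action at time [m.+1]. *)
Lemma law_hitting_cylinder pit s0 a0 n m x a :
  decision_rule M pit -> a0 \in adm M s0 ->
  law X pit s0 a0 (cylinder m x a `&` hitting m n) =
  (path_weight pit s0 a0 m x a * hit pit n m (x m) (a m))%:E.
Proof.
move=> pitM a0M; elim: n m x a => [|n IHn] m x a.
  rewrite mulr0 (_ : _ `&` _ = set0) ?measure0//.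
  apply/seteqP; split=> w //= -[_ [t]].
  by rewrite addn0 ltnNge => /andP[/negbTE->].
have mE := measurableI _ _ (measurable_cylinder m x a)
                           (measurable_hitting m n.+1).
rewrite (measure_finite_partition _ (g := state m.+1) mE); last first.
  exact: measurable_state.
rewrite [hit _ _ _ _ _]/= mulr_sumr -sumEFin; apply: eq_bigr => s' _.
have mE' := measurableI _ _ mE (measurable_state X m.+1 s').
rewrite (measure_finite_partition _ (g := action m.+1) mE'); last first.
  exact: measurable_action.
pose x' := upd x m.+1 s'.
have cylS b : cylinder m x a `&` [set w | state m.+1 w = s'] `&`
      [set w | action m.+1 w = b] = cylinder m.+1 x' (upd a m.+1 b).
  apply/seteqP; split=> w /=.
    move=> [[H sw] aw] t; rewrite /x' /upd; case: eqP => [->//|/eqP tm].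
    by rewrite leq_eqVlt (negbTE tm) => /H.
  move=> H; have := H m.+1 (leqnn _); rewrite /x' /upd eqxx => -[? ?].
  split=> //; split=> // t tm; have := H t (leqW tm).
  by rewrite /x' /upd ltn_eqF.
have wS b : path_weight pit s0 a0 m.+1 x' (upd a m.+1 b) =
    path_weight pit s0 a0 m x a * trans M (x m) (a m) s' *
    (b == pit m.+1 s')%:R.
  rewrite /path_weight big_ord_recr/= /x' /upd /= eqxx (ltn_eqF (ltnSn m)).
  rewrite !mulrA.
  congr (_ * _ * _ * _); apply: eq_bigr => t _.
  by rewrite eqSS !ltn_eqF ?ltnS// ltnW.
transitivity (\sum_b (path_weight pit s0 a0 m.+1 x' (upd a m.+1 b) *
    (if s' == sr then 1 else hit pit n m.+1 s' b))%:E)%E.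
  (* If [s'] is [sr], the hitting event is certain on the longer cylinder. Otherwise time [m.+1] is
     no hit, and the window of times shrinks to the [n] times after [m.+1], where the induction
     hypothesis applies. *)
  apply: eq_bigr => b _; case: eqP => [s'sr|s'sr].
    rewrite mulr1 -law_cylinder_weight// -cylS; congr (law _ _ _ _ _).
    apply/seteqP; split=> w /=; first by move=> [[[? _] ?] ?].
    move=> [[? sw] ?]; split=> //; split=> //; split=> //.
    by exists m.+1; rewrite ?sw// addnS ltnS leq_addr leqnn.
  have := IHn m.+1 x' (upd a m.+1 b).
  rewrite [hit _ _ _ _ _](_ : _ = hit pit n m.+1 s' b); last first.
    by rewrite /x' /upd eqxx.
  move=> <-; rewrite -cylS; congr (law _ _ _ _ _).
  apply/seteqP; split=> w /=.
    move=> [[[? [t /andP[mt tn] tw]] sw] aw]; split=> //.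
    exists t => //; rewrite addSnnS tn andbT ltn_neqAle mt andbT.
    by apply/eqP => mt'; apply: s'sr; rewrite -sw mt'.
  move=> [[[? sw] aw] [t /andP[mt tn] tw]]; do !split=> //.
  by exists t => //; rewrite -addSnnS tn andbT ltnW.
(* Only the action prescribed by the rule has positive weight. *)
rewrite (bigD1 (pit m.+1 s'))//= big1 ?adde0 => [|b /negbTE bpi].
  by rewrite wS eqxx mulr1 mulrA.
by rewrite wS bpi mulr0 mul0r.
Qed.

Lemma law_hitting pit s a n : decision_rule M pit -> a \in adm M s ->
  law X pit s a (hitting 0 n) = (hit pit n 0 s a)%:E.
Proof.
move=> pitM aM.
have mH := measurable_hitting 0 n.
have mC := measurable_cylinder 0 (fun=> s) (fun=> a).
have := law_hitting_cylinder n 0 (fun=> s) (fun=> a) pitM aM.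
rewrite /path_weight !eqxx big_ord0 !mul1r => <-.
have C1 : law X pit s a (cylinder 0 (fun=> s) (fun=> a)) = 1%E.
  by rewrite law_cylinder_weight// /path_weight !eqxx big_ord0 mul1r.
(* The process starts at [(s, a)] almost surely, so intersecting with the cylinder of length 0 loses
   nothing. *)
have D0 : law X pit s a (hitting 0 n `\` cylinder 0 (fun=> s) (fun=> a)) = 0%E.
  apply/eqP; rewrite eq_le measure_ge0 andbT.
  rewrite (@le_trans _ _ (law X pit s a (~` cylinder 0 (fun=> s) (fun=> a))))//.
    apply: le_measure; rewrite ?inE; [exact: measurableD|exact: measurableC|].
    by move=> w [].
  by rewrite probability_setC// C1 subee.
rewrite setIC -[RHS]add0e -[in RHS]D0; exact: measureDI.
Qed.

Lemma hit_cvg pit s a : decision_rule M pit -> a \in adm M s ->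
  (hit pit n 0 s a)%:E @[n --> \oo] --> reach_probability X pit s a sr.
Proof.
move=> pitM aM; rewrite /reach_probability.
have -> : [set w | exists2 t : nat, (1 <= t)%N & state t w = sr] =
    \bigcup_n hitting 0 n.
  apply/seteqP; split=> w /=.
    by move=> [t t1 tw]; exists t => //; exists t; rewrite ?t1/=.
  by move=> [n _ [t /andP[t0 _] tw]]; exists t.
rewrite (_ : (fun n => _) = law X pit s a \o hitting 0); last first.
  by apply/funext => n /=; rewrite law_hitting.
apply: nondecreasing_cvg_mu => //.
  exact: bigcup_measurable.
apply/nondecreasing_seqP => n; rewrite subsetEset => w [t /andP[t0 tn] tw].
by exists t => //; rewrite t0 (leq_trans tn)// leq_add2l.
Qed.

(** Squeeze: from below by [hit] for a rule attaining the maximum [r], which tends to [r] by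
    continuity of the law along increasing events; from above by [r], since [hit_opt n] is the
    probability that some rule reaches [sr] within [n] steps. *)
Lemma hit_opt_cvg s a r : a \in adm M s ->
  is_max [set p | exists2 pit, decision_rule M pit &
            p = reach_probability X pit s a sr] r%:E ->
  hit_opt n s a @[n --> \oo] --> r.
Proof.
move=> aM [[pit pitM rE] rmax].
have hr : hit pit n 0 s a @[n --> \oo] --> r.
  have := hit_cvg pitM aM; rewrite -rE => /fine_cvg.
  exact.
apply: (squeeze_cvgr _ hr (cvg_cst r)); apply: nearW => n /=.
rewrite hit_le_hit_opt//=; have [pit' pitM' <-] := hit_opt_attained n.
rewrite -lee_fin -law_hitting//.
apply: le_trans (rmax _ _); last by exists pit'.
apply: le_measure; rewrite ?inE.
- exact: measurable_hitting.
- by apply: bigcup_measurable => t _; exact: measurable_state.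
- by move=> w [t /andP[t0 _] tw]; exists t.
Qed.

End reachability.

(** * Tabular parameters *)

Section absorbing_theory.
Context (R : realType) (S A : finType) (M : mdp R S A).

Lemma absorbing_adm1 s a b : s \in absorbing_states M ->
  a \in adm M s -> b \in adm M s -> a = b.
Proof.
by rewrite inE => /asboolP[c [-> _ _]]; rewrite !inE => /eqP -> /eqP ->.
Qed.

Lemma trans_absorbing s a s' : s \in absorbing_states M -> a \in adm M s ->
  s' != s -> trans M s a s' = 0.
Proof.
rewrite inE => /asboolP[c [sM sc _]] aM s's.
have ac : a = c by move: aM; rewrite sM => /set1P.
have := trans_sum1 aM; rewrite (bigD1 s)//= ac sc -[RHS]addr0 => /addrI.
move/psumr_eq0P; apply=> // s'' _.
by rewrite trans_ge0 // -ac.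
Qed.

(** All mass stays at [s], which differs from [sr]. This agrees with the zero padding of [Qtab]. *)
Lemma hit_opt_absorbing sr n s a : sr \notin absorbing_states M ->
  s \in absorbing_states M -> a \in adm M s -> hit_opt M sr n s a = 0.
Proof.
move=> srM sM; elim: n a => [//|n IHn] a aM /=.
apply: big1 => s' _; have [->|s's] := eqVneq s' s; last first.
  by rewrite trans_absorbing ?mul0r.
case: ifP => [/eqP ssr|_]; first by rewrite -ssr sM in srM.
have [b bM ->] := max_adm_attained M s (hit_opt M sr n s).
by rewrite IHn ?mulr0.
Qed.

End absorbing_theory.

Section tabular_theory.
Context (R : realType) (S A : finType) (M : mdp R S A).
Context (nu : S * A -> 'I_(dTheta M + #|absorbing_states M|)).
Context (nuP : index_function nu).

Lemma index_function_inj s a s' a' : a \in adm M s -> a' \in adm M s' ->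
  nu (s, a) = nu (s', a') -> s = s' /\ a = a'.
Proof.
by move=> aM aM' /(set_bij_inj nuP.1); rewrite !inE => /(_ aM aM')[-> ->].
Qed.

(** Counting argument: the absorbing states, one pair each, already fill all the upper indices, so
    injectivity of [nu] leaves a lower index for every other pair. *)
Lemma index_nonabsorbing s a : s \notin absorbing_states M -> a \in adm M s ->
  exists i, nu (s, a) = lshift _ i.
Proof.
move=> sM aM; case: (splitP (nu (s, a))) => [i nui|j nuj].
  by exists i; exact: val_inj.
have [pi [piM _]] := exists_greedy M (fun _ _ => 0).
pose f s' := nu (s', pi s').
have finj : {in absorbing_states M &, injective f}.
  by move=> s1 s2 _ _ /index_function_inj[].
have : f @: absorbing_states M \subset
    @rshift (dTheta M) #|absorbing_states M| @: [set: _]%SET.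
  apply/fintype.subsetP => _ /imsetP[s' s'M ->]; have := nuP.2 _ _ s'M (piM s').
  rewrite /f; case: (splitP (nu (s', pi s'))) => k nuk.
    by rewrite nuk leqNgt ltn_ord.
  by move=> _; apply/imsetP; exists k => //; exact: val_inj.
move=> /subset_cardP; rewrite !card_in_imset//; last first.
  by move=> x y _ _ /rshift_inj.
rewrite cardsT card_ord => /(_ erefl)/(_ (nu (s, a))).
have -> : nu (s, a) = rshift _ j by exact: val_inj.
rewrite imset_f ?inE// => /imsetP[s' s'M nus'].
have : nu (s, a) = f s' by rewrite -nus'; exact: val_inj.
by move=> /index_function_inj[]// ss' _; rewrite ss' s'M in sM.
Qed.

Lemma Qtab_absorbing theta s a : s \in absorbing_states M -> a \in adm M s ->
  Qtab nu theta s a = 0.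
Proof.
move=> sM aM; have := nuP.2 _ _ sM aM; rewrite /Qtab mxE.
by case: splitP => [i ->|j _ _]; rewrite ?mxE// leqNgt ltn_ord.
Qed.

Lemma Qtab_lshift theta s a i : nu (s, a) = lshift _ i ->
  Qtab nu theta s a = theta 0 i.
Proof. by move=> e; rewrite /Qtab e row_mxEl. Qed.

Lemma Qtab_linear theta c u s a :
  Qtab nu (theta + c *: u) s a = Qtab nu theta s a + c * Qtab nu u s a.
Proof.
by rewrite /Qtab !mxE; case: splitP => j _; rewrite !mxE// mulr0 addr0.
Qed.

(** * Bellman equation for the maximal reach probabilities *)

Section reach_parameter.
Context (X : process M) (sr : S) (u : 'rV[R]_(dTheta M)).
Context (hu : forall (i : 'I_(dTheta M)) (s : S) (a : A), a \in adm M s ->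
  nu (s, a) = lshift _ i ->
  is_max [set p | exists2 pit, decision_rule M pit &
            p = reach_probability X pit s a sr] (u 0 i)%:E).
Context (sr_recurrent :
  exists pi, policy M pi /\ nongoal_recurrent X pi sr).

Let sr_nonabsorbing : sr \notin absorbing_states M.
Proof. by have [pi [_ []]] := sr_recurrent. Qed.

Lemma hit_opt_cvg_Qtab s a : a \in adm M s ->
  hit_opt M sr n s a @[n --> \oo] --> Qtab nu u s a.
Proof.
move=> aM; have [sM|sM] := boolP (s \in absorbing_states M).
  rewrite Qtab_absorbing// (_ : (fun n => _) = cst 0); first exact: cvg_cst.
  by apply/funext => n; exact: hit_opt_absorbing.
have [i nui] := index_nonabsorbing sM aM.
by rewrite (Qtab_lshift _ nui); exact: hit_opt_cvg aM (hu aM nui).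
Qed.

Lemma hit_opt_le_Qtab n s a : a \in adm M s ->
  hit_opt M sr n s a <= Qtab nu u s a.
Proof.
move=> aM; have cu := hit_opt_cvg_Qtab aM.
rewrite -(cvg_lim _ cu)//.
apply: (nondecreasing_cvgn_le (u_ := fun n => hit_opt M sr n s a)).
  exact: hit_opt_nd.
by apply/cvg_ex; exists (Qtab nu u s a).
Qed.

(** The stationary policy under which [sr] is recurrent returns to [sr] with probability 1. Hence
    the stopping value 1 in [hit_opt] equals the maximum of [Qtab nu u] at [sr], and the recursion
    has a Bellman equation as its limit. *)
Lemma max_Qtab_recurrent : max_adm M sr (Qtab nu u sr) = 1.
Proof.
have Qle1 a : a \in adm M sr -> Qtab nu u sr a <= 1.
  move=> aM; have [i nui] := index_nonabsorbing sr_nonabsorbing aM.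
  have [[pit _ uE] _] := hu aM nui.
  rewrite (Qtab_lshift _ nui) -lee_fin uE; apply: probability_le1.
  by apply: bigcup_measurable => t _; exact: measurable_state.
have [pi [piM [_ pi1 _]]] := sr_recurrent.
have [i nui] := index_nonabsorbing sr_nonabsorbing (piM sr).
have Qpi : Qtab nu u sr (pi sr) = 1.
  apply/le_anti; rewrite Qle1//= (Qtab_lshift _ nui) -lee_fin -pi1.
  by have [_] := hu (piM sr) nui; apply; exists (fun=> pi).
by rewrite (max_admE (piM sr)) Qpi.
Qed.

Lemma Qtab_bellman s a : a \in adm M s ->
  Qtab nu u s a = \sum_s' trans M s a s' * max_adm M s' (Qtab nu u s').
Proof.
move=> aM; have [pi [piM piE]] := exists_greedy M (Qtab nu u).
(* Lower bound with the actions frozen to a greedy policy of the limit table, so that the limit is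
   taken termwise without exchanging it with a maximum. *)
pose w n s' := if s' == sr then 1 else hit_opt M sr n s' (pi s').
have wle n : \sum_s' trans M s a s' * w n s' <= hit_opt M sr n.+1 s a.
  apply: ler_sum => s' _; apply: ler_wpM2l; first exact: trans_ge0.
  by rewrite /w; case: ifP => // _; exact: max_adm_ge.
have lew n : hit_opt M sr n.+1 s a <=
    \sum_s' trans M s a s' * max_adm M s' (Qtab nu u s').
  apply: ler_sum => s' _; apply: ler_wpM2l; first exact: trans_ge0.
  case: ifP => [/eqP ->|_]; first by rewrite max_Qtab_recurrent.
  have [b bM ->] := max_adm_attained M s' (hit_opt M sr n s').
  exact: le_trans (hit_opt_le_Qtab n bM) (max_adm_ge _ bM).
have cw : \sum_s' trans M s a s' * w n s' @[n --> \oo] -->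
    \sum_s' trans M s a s' * max_adm M s' (Qtab nu u s').
  apply: cvg_big => [|s' _]; first exact: add_continuous.
  apply: cvgMr; rewrite /w.
  have [->|_] := eqVneq s' sr.
    by rewrite max_Qtab_recurrent; exact: cvg_cst.
  by rewrite piE; exact: hit_opt_cvg_Qtab.
have cq : hit_opt M sr n.+1 s a @[n --> \oo] --> Qtab nu u s a.
  rewrite (cvg_shiftS (fun n => hit_opt M sr n s a)).
  exact: hit_opt_cvg_Qtab.
apply: (cvg_unique _ cq) => //.
by apply: (squeeze_cvgr _ cw (cvg_cst _)); apply: nearW => n; rewrite wle lew.
Qed.

End reach_parameter.
End tabular_theory.

(** * A box of parameters with likelihood constant along [u] *)

Theorem theorem4 (R : realType) (S A : finType) (M : mdp R S A)
    (X : process M) (sg : S)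
    (hU : assumption_U X sg)
    (hR : deterministic_rewards M \/ gaussian_rewards M)
    (nu : S * A -> 'I_(dTheta M + #|absorbing_states M|))
    (hnu : index_function nu)
    (sr : S)
    (hsr : exists pi : S -> A,
      [/\ policy M pi, ~ proper_policy X sg pi & nongoal_recurrent X pi sr])
    (u : 'rV[R]_(dTheta M))
    (u01 : forall i, 0 <= u 0 i <= 1)
    (hu : forall (i : 'I_(dTheta M)) (s : S) (a : A), a \in adm M s ->
      nu (s, a) = lshift _ i ->
      is_max [set p | exists2 pit, decision_rule M pit &
                p = reach_probability X pit s a sr] (u 0 i)%:E) :
  exists O : set 'rV[R]_(dTheta M),
    [/\ (@lebesgue_rV R (dTheta M)).-caratheodory O,
        lebesgue_rV O <> 0%E &
        forall theta, O theta -> exists2 c0 : R, c0 <= 0 &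
          forall c : R, c0 < c ->
          forall eps : R, 0 < eps ->
          forall D : seq (S * A * R), dataset M D ->
            likelihood nu eps D theta = likelihood nu eps D (theta + c *: u)].
Proof.
have [pi [piM _ sr_rec]] := hsr.
have bellman := Qtab_bellman hnu hu (ex_intro _ pi (conj piM sr_rec)).
have [astar [astarM astarE]] := exists_greedy M (Qtab nu u).
pose l : 'rV[R]_(dTheta M) :=
  \row_i (if [exists s, nu (s, astar s) == lshift _ i] then 2 else 0).
exists (box l (l + const_mx 1)); split.
- exact: caratheodory_box.
- apply/eqP; rewrite gt_eqF//; apply: lt_le_trans (lebesgue_rV_box _).
    by rewrite lte_fin prodr_gt0// => i _; rewrite !mxE addrAC subrr add0r.
  by move=> i; rewrite !mxE lerDl.
move=> theta thetaO; exists 0 => // c c0 eps _ D DM.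
(* Stated for all [c' >= 0] so as to cover both [theta] ([c' = 0]) and the shifted parameter. As
   [astar] is greedy for [theta] and for [u], it is greedy for the combination. *)
have maxE c' s : 0 <= c' -> max_adm M s (Qtab nu (theta + c' *: u) s) =
    Qtab nu theta s (astar s) + c' * Qtab nu u s (astar s).
  move=> c'0; rewrite -Qtab_linear; apply: max_admE => // a aM.
  rewrite !Qtab_linear lerD ?ler_wpM2l// -?astarE ?max_adm_ge//.
  have [->//|aa] := eqVneq a (astar s).
  (* An absorbing state has a single admissible action, so two distinct ones force [s] to be
     non-absorbing and both entries to be genuine parameters. *)
  have sM : s \notin absorbing_states M.
    apply: contra aa => sM; apply/eqP.
    exact: absorbing_adm1 sM aM (astarM s).
  have [i nui] := index_nonabsorbing hnu sM aM.
  have [j nuj] := index_nonabsorbing hnu sM (astarM s).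
  rewrite (Qtab_lshift _ nui) (Qtab_lshift _ nuj).
  have /andP[_] := thetaO i; have /andP[+ _] := thetaO j.
  rewrite !mxE ifT; last by apply/existsP; exists s; rewrite nuj.
  rewrite ifF => [jge ile|].
    by rewrite (le_trans ile)// (le_trans _ jge)// add0r ler1n.
  (* By injectivity of [nu], the coordinate of [(s, a)] is not an [astar] coordinate of any state,
     so its lower corner is 0. *)
  apply/existsP => -[s' /eqP]; rewrite -nui.
  move=> /(index_function_inj hnu (astarM s') aM)[ss' aa'].
  by rewrite -aa' -ss' eqxx in aa.
have maxE0 s : max_adm M s (Qtab nu theta s) = Qtab nu theta s (astar s).
  by have := maxE 0 s (lexx _); rewrite scale0r addr0 mul0r addr0.
apply: eq_big_seq => -[[s a] r] /DM aM; congr (normal_pdf _ eps r).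
under eq_bigr do rewrite maxE0.
under [in RHS]eq_bigr do rewrite (maxE _ _ (ltW c0)) mulrDr.
(* The mean of the normal density changes by [c] times the Bellman residual of [Qtab nu u], which is
   zero by [bellman]. *)
rewrite big_split/= Qtab_linear (bellman _ _ aM) mulr_sumr.
under [X in _ = _ + X - _]eq_bigr do rewrite astarE mulrCA.
by rewrite opprD addrACA subrr addr0.
Qed.
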